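(* Let $m,k$ be positive integers, $\delta\in\mathbb{F}_{2^{2m}}$, and $i$ an integer with $0<i<m$. Let $$f_2(x)=x+\left(\mathrm{Tr}_m^{2m}(x)^k+\delta\right)^{2^i+1}+\left(\mathrm{Tr}_m^{2m}(x)^k+\delta\right)^{2^m+2^i},$$ $$f_3(x)=x+\left(\mathrm{Tr}_m^{2m}(x)^k+\delta\right)^{2^i+1}+\left(\mathrm{Tr}_m^{2m}(x)^k+\delta\right)^{2^{m+i}+1}.$$ Then $f_2$ and $f_3$ are permutation polynomials of $\mathbb{F}_{2^{2m}}$ and, writing $E=(\delta+\delta^{2^m})^{2^i+1}$, their compositional inverses over $\mathbb{F}_{2^{2m}}$ are $$f_2^{-1}(x)=x+\left(\left(\mathrm{Tr}_m^{2m}(x)+E\right)^k+\delta\right)^{2^i+1}+\left(\left(\mathrm{Tr}_m^{2m}(x)+E\right)^k+\delta\right)^{2^i+2^m},$$ $$f_3^{-1}(x)=x+\left(\left(\mathrm{Tr}_m^{2m}(x)+E\right)^k+\delta\right)^{2^i+1}+\left(\left(\mathrm{Tr}_m^{2m}(x)+E\right)^k+\delta\right)^{2^{m+i}+1}.$$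
   Context: $\mathrm{Tr}_m^{2m}(x)=x+x^{2^m}$ is the trace map from $\mathbb{F}_{2^{2m}}$ to $\mathbb{F}_{2^m}$. The compositional inverse of a permutation polynomial $F$ of a finite field $\mathbb{F}$ is the unique polynomial map $F^{-1}$ with $F(F^{-1}(x))=F^{-1}(F(x))=x$ for all $x\in\mathbb{F}$. *)

(* Defs.v *)
From HB Require Import structures.
From mathcomp Require Import all_boot all_order all_algebra.

Set Implicit Arguments.
Unset Strict Implicit.
Unset Printing Implicit Defensive.

Import GRing.Theory.
Local Open Scope ring_scope.

(* Polynomials are formal ({poly F}); their induced maps are x |-> p.[x]. *)
Definition permutation_poly (F : finFieldType) (p : {poly F}) : Prop :=
  bijective (fun x : F => p.[x]).

(* Over a finite field the compositional inverse is unique as a map only: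
   distinct formal polynomials may induce the same map. *)
Definition compositional_inverse (F : finFieldType) (p q : {poly F}) : Prop :=
  forall x : F, p.[q.[x]] = x /\ q.[p.[x]] = x.

(* Intended for #|F| = 2 ^ (2 * m), where the induced map is the trace of F
   over its subfield of order 2 ^ m. *)
Definition trace_poly (F : finFieldType) (m : nat) : {poly F} :=
  'X + 'X ^+ (2 ^ m)%N.

Definition f2 (F : finFieldType) (m k i : nat) (delta : F) : {poly F} :=
  'X + (trace_poly F m ^+ k + delta%:P) ^+ (2 ^ i + 1)%N
     + (trace_poly F m ^+ k + delta%:P) ^+ (2 ^ m + 2 ^ i)%N.

Definition f3 (F : finFieldType) (m k i : nat) (delta : F) : {poly F} :=
  'X + (trace_poly F m ^+ k + delta%:P) ^+ (2 ^ i + 1)%N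
     + (trace_poly F m ^+ k + delta%:P) ^+ (2 ^ (m + i) + 1)%N.

Definition trace_shift (F : finFieldType) (m i : nat) (delta : F) : F :=
  (delta + delta ^+ (2 ^ m)%N) ^+ (2 ^ i + 1)%N.

Definition f2_inv (F : finFieldType) (m k i : nat) (delta : F) : {poly F} :=
  let E := trace_shift m i delta in
  'X + ((trace_poly F m + E%:P) ^+ k + delta%:P) ^+ (2 ^ i + 1)%N
     + ((trace_poly F m + E%:P) ^+ k + delta%:P) ^+ (2 ^ i + 2 ^ m)%N.

Definition f3_inv (F : finFieldType) (m k i : nat) (delta : F) : {poly F} :=
  let E := trace_shift m i delta in
  'X + ((trace_poly F m + E%:P) ^+ k + delta%:P) ^+ (2 ^ i + 1)%N
     + ((trace_poly F m + E%:P) ^+ k + delta%:P) ^+ (2 ^ (m + i) + 1)%N.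

(* Main.v *)
(* Write t = Tr x and D = delta + delta^(2^m).  As t^k is fixed by the
   2^m-power map, c = t^k + delta has trace D, so f_2 x = x + c^(2^i) D and
   f_3 x = x + c D^(2^i).  Both corrections have trace D^(2^i) D = E whatever
   x is: the trace of the image is t + E, which determines t, hence c, and the
   correction is then undone by adding it again. *)
Require Import Defs.
From HB Require Import structures.
From mathcomp Require Import all_boot all_order all_algebra all_field.

Set Implicit Arguments.
Unset Strict Implicit.
Unset Printing Implicit Defensive.

Import GRing.Theory.
Local Open Scope ring_scope.

Lemma exprD_pchar2 (R : comNzRingType) (n : nat) (x y : R) :
  2%N \in [pchar R] -> (x + y) ^+ (2 ^ n) = x ^+ (2 ^ n) + y ^+ (2 ^ n).
Proof.
move=> char2; apply: exprDn_pchar.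
by rewrite pnatX (pnatE _ (pcharf_prime char2)) char2.
Qed.

Lemma compositional_inverse_permutation (F : finFieldType) (p q : {poly F}) :
  compositional_inverse p q -> permutation_poly p.
Proof. by move=> pq; exists (fun x => q.[x]) => x; case: (pq x). Qed.

Section TraceShift.

Variables (F : finFieldType) (m k : nat) (delta E : F) (g : F -> F).
Hypothesis cardF : #|F| = (2 ^ (2 * m))%N.

Let tr (x : F) := x + x ^+ (2 ^ m).

Hypothesis tr_g : forall c, tr c = tr delta -> tr (g c) = E.

Lemma pchar2_of_card : (0 < m)%N -> 2%N \in [pchar F].
Proof. by move=> m_gt0; apply: (card_finPcharP cardF). Qed.

Hypothesis char2 : 2%N \in [pchar F].

Lemma exprq_involutive (x : F) : (x ^+ (2 ^ m)) ^+ (2 ^ m) = x.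
Proof. by rewrite -exprM -expnD addnn -mul2n -cardF expf_card. Qed.

Lemma trD (x y : F) : tr (x + y) = tr x + tr y.
Proof. by rewrite /tr exprD_pchar2 // addrACA. Qed.

Lemma tr_fixed (x : F) : tr x ^+ (2 ^ m) = tr x.
Proof. by rewrite /tr exprD_pchar2 // exprq_involutive addrC. Qed.

(** With [t] also [t ^+ k] is fixed, so its trace is twice itself, that is 0. An arbitrary fixed [t]
    covers both [tr x], used by [p], and [tr y + E], used by [q]. *)
Lemma tr_fixedX (t : F) : t ^+ (2 ^ m) = t -> tr (t ^+ k + delta) = tr delta.
Proof.
by move=> tq; rewrite trD {1}/tr exprAC tq addrr_pchar2 // add0r.
Qed.

(** Treats both families at once: all that is asked of the correction [g] is the constant trace [E]
    on elements with the trace of [delta]. Each map then shifts traces by [E], an involution in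
    characteristic 2. *)
Lemma trace_shift_inverse (p q : {poly F}) :
    (forall x, p.[x] = x + g (tr x ^+ k + delta)) ->
    (forall y, q.[y] = y + g ((tr y + E) ^+ k + delta)) ->
  compositional_inverse p q.
Proof.
move=> pE qE x.
have trp y : tr p.[y] = tr y + E.
  by rewrite pE trD tr_g // tr_fixedX // tr_fixed.
(* [E] is itself a trace, that of [g delta], hence fixed. *)
have Eq : E ^+ (2 ^ m) = E.
  by rewrite -(tr_g (erefl (tr delta))) tr_fixed.
have trq : tr q.[x] = tr x + E.
  by rewrite qE trD tr_g // tr_fixedX // exprD_pchar2 // tr_fixed Eq.
split.
  (* Both maps add the same value of [g], at [(tr x + E) ^+ k + delta]. *)
  by rewrite pE trq qE -addrA addrr_pchar2 // addr0.
(* In this order the two shifts cancel first: [tr x + E + E = tr x]. *)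
by rewrite qE trp -(addrA (tr x)) addrr_pchar2 // addr0 pE -addrA
           addrr_pchar2 // addr0.
Qed.

End TraceShift.

Theorem theorem13 (F : finFieldType) (m k i : nat) (delta : F)
    (m_gt0 : (0 < m)%N) (k_gt0 : (0 < k)%N)
    (cardF : #|F| = (2 ^ (2 * m))%N) (i_bounds : (0 < i < m)%N) :
  permutation_poly (f2 m k i delta)
  /\ permutation_poly (f3 m k i delta)
  /\ compositional_inverse (f2 m k i delta) (f2_inv m k i delta)
  /\ compositional_inverse (f3 m k i delta) (f3_inv m k i delta).
Proof.
have char2 := pchar2_of_card cardF m_gt0.
(* The trace is linear over the subfield of fixed elements. *)
have trM (c d : F) : d ^+ (2 ^ m) = d ->
    c * d + (c * d) ^+ (2 ^ m) = (c + c ^+ (2 ^ m)) * d.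
  by move=> dq; rewrite exprMn dq mulrDl.
have fixX (d : F) n : d ^+ (2 ^ m) = d -> (d ^+ n) ^+ (2 ^ m) = d ^+ n.
  by move=> dq; rewrite exprAC dq.
have trq c := tr_fixed cardF char2 c.
have inv2 : compositional_inverse (f2 m k i delta) (f2_inv m k i delta).
  pose g (c : F) := c ^+ (2 ^ i + 1)%N + c ^+ (2 ^ m + 2 ^ i)%N.
  apply: (@trace_shift_inverse F m k delta (trace_shift m i delta) g) => //.
  (* The fixed factor is the trace of [c]; the other, [c ^+ (2 ^ i)], has as its trace the
     [2 ^ i]-th power of that of [c], since Frobenius powers commute and are additive. *)
  - move=> c trc; have -> : g c = c ^+ (2 ^ i) * (c + c ^+ (2 ^ m)).
      by rewrite /g !exprD expr1 mulrDr [c ^+ (2 ^ m) * _]mulrC.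
    by rewrite (trM _ _ (trq c)) exprAC -exprD_pchar2 // trc
               /trace_shift exprD expr1.
  - by move=> x; rewrite /f2 /trace_poly !hornerE.
  - by move=> x; rewrite /f2_inv /trace_poly [(2 ^ i + 2 ^ m)%N]addnC !hornerE.
have inv3 : compositional_inverse (f3 m k i delta) (f3_inv m k i delta).
  pose g (c : F) := c ^+ (2 ^ i + 1)%N + c ^+ (2 ^ (m + i) + 1)%N.
  apply: (@trace_shift_inverse F m k delta (trace_shift m i delta) g) => //.
  (* As [c ^+ (2 ^ (m + i))] is the [2 ^ i]-th power of [c ^+ (2 ^ m)], the cofactor of [c] is a
     power of its trace, again fixed. *)
  - move=> c trc; have -> : g c = c * (c + c ^+ (2 ^ m)) ^+ (2 ^ i).
      by rewrite exprD_pchar2 // -exprM -expnD /g !exprD expr1 -mulrDl mulrC.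
    rewrite trM; last exact: fixX.
    by rewrite trc /trace_shift exprD expr1 mulrC.
  - by move=> x; rewrite /f3 /trace_poly !hornerE.
  - by move=> x; rewrite /f3_inv /trace_poly !hornerE.
split; first exact: compositional_inverse_permutation inv2.
by split; first exact: compositional_inverse_permutation inv3.
Qed.
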